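(* Let $\beta\in\mathbb{C}$ with $|\beta|>1$ be an algebraic number which has an algebraic conjugate $\gamma$ with $|\gamma|=1$, and let $\mathcal A\subset\mathbb Z$ be a finite alphabet of contiguous integers containing $0$. Then addition on $\mathcal A$ is not block parallel computable in base $\beta$, i.e., there is no $k\geqslant 1$ for which $k$-block parallel addition in base $\beta$ on $\mathcal A$ is possible.
   Context: For a base $\beta$ with $|\beta|>1$, an alphabet $\mathcal A$ and $k\geqslant1$, put $\mathcal A_{(k)}=\{a_0+a_1\beta+\cdots+a_{k-1}\beta^{k-1}: a_i\in\mathcal A\}$. A function $\varphi:\mathcal C^{\mathbb Z}\to\mathcal D^{\mathbb Z}$ is $p$-local if there are integers $r,t\geqslant0$ with $p=r+t+1$ and a function $\Phi:\mathcal C^p\to\mathcal D$ such that for every $u=(u_j)_{j\in\mathbb Z}$ the image $v=\varphi(u)$ satisfies $v_j=\Phi(u_{j+t}\cdots u_{j-r})$ for all $j\in\mathbb Z$. For a base $\delta$ with $|\delta|>1$ and finite sets $\mathcal C,\mathcal D\subset\mathbb C$ containing $0$, a digit set conversion in base $\delta$ from $\mathcal C$ to $\mathcal D$ is a map $\varphi:\mathcal C^{\mathbb Z}\to\mathcal D^{\mathbb Z}$ such that every sequence with finitely many non-zero entries is mapped to a sequence with finitely many non-zero entries, and $\sum_j v_j\delta^j=\sum_j u_j\delta^j$ where $v=\varphi(u)$. $k$-block parallel addition in base $\beta$ on $\mathcal A$ is possible (addition on $\mathcal A$ is $k$-block parallel computable) if there is a digit set conversion in base $\beta^k$ from $\mathcal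 A_{(k)}+\mathcal A_{(k)}$ to $\mathcal A_{(k)}$ which is $p$-local for some $p\in\mathbb N$. Addition is block parallel computable if it is $k$-block parallel computable for some $k\geqslant1$.
   Formalization: The alphabet is additionally assumed to be different from {0}; for the alphabet {0} every block alphabet is {0}, the identity is a 1-local digit set conversion, and the claim fails. *)

(* Defs.v *)
From HB Require Import structures.
From mathcomp Require Export all_boot all_order all_algebra complex.
From mathcomp Require Export all_classical all_reals.
Set Implicit Arguments. Unset Strict Implicit. Unset Printing Implicit Defensive.
Import Order.TTheory GRing.Theory Num.Theory.
Local Open Scope classical_set_scope.
Local Open Scope complex_scope.
Local Open Scope ring_scope.

Section AlgebraicNumbers.
Variable K : numFieldType.

Definition algebraic_number (x : K) : Prop := algebraicOver (@ratr K) x.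

Definition minimal_polynomial (x : K) (p : {poly rat}) : Prop :=
  [/\ p \is monic, root (map_poly ratr p) x &
      forall q : {poly rat}, q != 0 -> root (map_poly ratr q) x ->
        (size p <= size q)%N].

Definition algebraic_conjugate (x y : K) : Prop :=
  exists2 p, minimal_polynomial x p & root (map_poly ratr p) y.

End AlgebraicNumbers.

Definition contiguous (A : set int) : Prop :=
  forall a b c : int, A a -> A c -> a <= b <= c -> A b.

(* Bi-infinite words over C : set K are functions int -> C, with C coerced to
   the subtype of its elements. *)
Section Conversions.
Variable K : numFieldType.

Definition local_function (C D : set K) (p : nat)
    (phi : (int -> C) -> (int -> D)) : Prop :=
  exists r t : nat, p = (r + t + 1)%N /\
    exists Phi : p.-tuple C -> D, forall (u : int -> C) (j : int),
      phi u j = Phi [tuple u (j + t%:Z - (i : nat)%:Z) | i < p].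

Definition finitely_supported (C : set K) (u : int -> C) : Prop :=
  finite_set [set j | val (u j) != 0].

(* Only meaningful for finitely supported u: the finitary sum defaults to 0 on
   infinite supports. *)
Definition value (delta : K) (C : set K) (u : int -> C) : K :=
  \sum_(j \in [set: int]) val (u j) * delta ^ j.

Definition digit_set_conversion (delta : K) (C D : set K)
    (phi : (int -> C) -> (int -> D)) : Prop :=
  forall u : int -> C, finitely_supported u ->
    finitely_supported (phi u) /\ value delta (phi u) = value delta u.

Definition block_alphabet (beta : K) (A : set K) (k : nat) : set K :=
  [set \sum_(i < k) a i * beta ^+ i | a in [set a : 'I_k -> K | forall i, A (a i)]].

Definition sumset (B C : set K) : set K := [set x + y | x in B & y in C].

Definition block_parallel_addition (beta : K) (A : set K) (k : nat) : Prop :=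
  let B := block_alphabet beta A k in
  exists phi : (int -> sumset B B) -> (int -> B),
    digit_set_conversion (beta ^+ k) phi /\ exists p, local_function p phi.

Definition block_parallel_computable (beta : K) (A : set K) : Prop :=
  exists2 k : nat, (1 <= k)%N & block_parallel_addition beta A k.

End Conversions.

(* Main.v *)
(** Replacing [beta] by its conjugate [gamma] turns block digits into finitely
    many numbers of modulus at most [M] and the base into [eta = gamma ^+ k], of
    modulus [1]. Let [S n] be the supremum of the moduli of the values in base
    [eta] of words of length [n]. Adding a word to itself doubles its value, while
    a local conversion lengthens it by at most [r + t] digits, so
    [2 * S n <= S n + (r + t) * M]; hence [S] is bounded. On the other hand a
    suitable subset of [n] unimodular numbers has a sum of modulus at least
    [n / 4], so [S n >= n / 4] already for digits in [{0, a}], [a != 0]. *)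
Require Import Defs.
From mathcomp Require Import all_boot all_order all_algebra complex.
From mathcomp Require Import all_classical all_reals.
From mathcomp Require Import zify lra.
Set Implicit Arguments. Unset Strict Implicit. Unset Printing Implicit Defensive.
Import Order.TTheory GRing.Theory Num.Theory.
Local Open Scope classical_set_scope.
Local Open Scope complex_scope.
Local Open Scope ring_scope.

(** * Passing rational relations to algebraic conjugates *)

Lemma minimal_polynomial_dvdp (K : numFieldType) (x : K) (p q : {poly rat}) :
  minimal_polynomial x p -> root (map_poly ratr q) x -> p %| q.
Proof.
move=> [mon_p px0 min_p] qx0; apply/modp_eq0P; apply/eqP/contraT => nz.
have := min_p _ nz; rewrite leqNgt ltn_modp monic_neq0 // => /(_ _)/negP[] //.
move: qx0; rewrite {1}(divp_eq q p) rmorphD rmorphM /= /root hornerD hornerM.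
by rewrite (eqP px0) mulr0 add0r.
Qed.

Lemma conjugate_root (K : numFieldType) (x y : K) (q : {poly rat}) :
  algebraic_conjugate x y -> root (map_poly ratr q) x -> root (map_poly ratr q) y.
Proof.
move=> [p min_p py0] /(minimal_polynomial_dvdp min_p) pq.
by apply: (root_dvdp (p := map_poly ratr p)) => //; rewrite dvdp_map.
Qed.

(** * Words supported on finitely many nonnegative positions *)

Section NatSupport.
Context {K : numFieldType} {C : set K} (u : int -> C) (N : nat).
Hypothesis suppu : forall j, val (u j) != 0 -> exists2 i, (i < N)%N & j = Posz i.

Lemma finitely_supported_nat : finitely_supported u.
Proof.
apply: (sub_finite_set (B := Posz @` `I_N)).
  by move=> j /= /suppu[i iN ->]; exists i.
by apply: finite_image; exact: finite_II.
Qed.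

Lemma value_nat (delta : K) :
  value delta u = \sum_(i < N) val (u i) * delta ^+ i.
Proof.
rewrite /value (fsbig_ord _ _ (fun i => val (u (Posz i)) * delta ^+ i)).
rewrite -(@fsbig_image _ _ _ _ _ `I_N Posz
  (fun j => val (u j) * delta ^ j)); last first.
  by move=> i j _ _ [].
apply/esym/fsbig_widen => // j [_ /= nj].
have [->|/suppu[i iN jE]] := eqVneq (val (u j)) 0; first by rewrite mul0r.
by exfalso; apply: nj; exists i.
Qed.

End NatSupport.

(** * How far a local conversion can spread the support *)

Section LocalConversion.
Context {K : numFieldType} {delta : K} {C D : set K}.
Context (phi : (int -> C) -> int -> D) (r t p : nat).
Context (Phi : p.-tuple C -> D).
Hypothesis pE : p = (r + t + 1)%N.
Hypothesis phiE : forall u j,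
  phi u j = Phi [tuple u (j + t%:Z - (i : nat)%:Z) | i < p].
Hypothesis phi_conv : digit_set_conversion delta phi.

(** The local rule sends the zero word to a constant word, which must have finite support; the
    constant is therefore zero, and it is the digit produced by any zero window. *)
Lemma local_conversion_zero_window (u : int -> C) (j : int) :
  (forall l, j - r%:Z <= l <= j + t%:Z -> val (u l) = 0) -> val (phi u j) = 0.
Proof.
move=> u0.
(* The letter [u j] lies in its own window, so it has value zero and supplies a zero word over
   [C]. *)
pose z : int -> C := fun=> u j.
have uj0 : val (u j) = 0 by apply: u0; lia.
have supp_z : finitely_supported z.
  rewrite /finitely_supported (_ : [set _ | _] = set0) // -subset0 => l /=.
  by rewrite uj0 eqxx.
have phi_z l : phi z l = phi u j.
  rewrite !phiE; congr Phi; apply: eq_mktuple => i.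
  by apply/val_inj; rewrite uj0 u0 //; have := ltn_ord i; lia.
have [fin_z _] := phi_conv supp_z.
apply/eqP/contraT => nz; move: fin_z; rewrite /finitely_supported.
have -> : [set l | val (phi z l) != 0] = [set: int].
  by rewrite -subTset => l _ /=; rewrite phi_z.
move=> finT; exfalso; apply: infinite_nat.
apply: (sub_finite_set (B := Posz @^-1` [set: int])) => //.
by apply: finite_preimage => // i k _ _ [].
Qed.

(** A nonzero output digit at [j] needs a nonzero input digit between [j - r] and [j + t]. Starting
    the input at position [t] thus keeps the output at nonnegative positions, and both values are
    polynomial in [delta]. *)
Lemma local_conversion_nat (u : nat -> C) (zero : C) (n : nat) : val zero = 0 ->
  exists v : nat -> D, \sum_(t <= i < t + n) val (u i) * delta ^+ i =
    \sum_(0 <= i < t + n + r) val (v i) * delta ^+ i.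
Proof.
move=> zero0.
pose w (j : int) : C :=
  if j is Posz i then if (t <= i < t + n)%N then u i else zero else zero.
have w_supp j : val (w j) != 0 -> exists2 i, (t <= i < t + n)%N & j = Posz i.
  rewrite /w; case: j => [i|i]; last by rewrite zero0 eqxx.
  by case: ifP => [|_]; [exists i | rewrite zero0 eqxx].
have w_nat j : val (w j) != 0 -> exists2 i, (i < t + n)%N & j = Posz i.
  by move=> /w_supp[i /andP[_ ?] ->]; exists i.
have v_nat j : val (phi w j) != 0 -> exists2 i, (i < t + n + r)%N & j = Posz i.
  move=> nz; have [l lj wl] : exists2 l, j - r%:Z <= l <= j + t%:Z & val (w l) != 0.
    apply: contrapT => no; move/eqP: nz; apply; apply: local_conversion_zero_window.
    by move=> l lj; apply/eqP/contraT => wl; exfalso; apply: no; exists l.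
  by have [i ti lE] := w_supp _ wl; exists `|j|%N; lia.
have [_ eq_val] := phi_conv (finitely_supported_nat w_nat).
exists (fun i => phi w (Posz i)).
rewrite big_mkord -(value_nat v_nat) eq_val (value_nat w_nat).
rewrite -(big_mkord xpredT (fun i => val (w (Posz i)) * delta ^+ i)).
rewrite [RHS](big_cat_nat (n := t)) //= ?leq_addr //.
rewrite [X in _ = X + _]big_nat_cond [X in _ = X + _]big1 ?add0r.
  by apply: eq_big_nat => i ti; rewrite ti.
by move=> i /andP[/andP[_ it] _]; rewrite leqNgt it /= zero0 mul0r.
Qed.

End LocalConversion.

(** * Subset sums of unimodular numbers, and the doubling argument *)

Section UnimodularSums.
Variable R : realType.
Implicit Types c : R.

Lemma le_complex_norm (x : R[i]) c :
  `|x| <= c%:C -> `|complex.Re x| <= c /\ `|complex.Im x| <= c.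
Proof.
move=> xc; have cR (y : R[i]) : `|y| <= c%:C -> `|complex.Re y| <= c.
  by move=> /(le_trans (normc_ge_Re y)); rewrite lecR.
split; first exact: cR.
(* Multiplication by ['i] keeps the modulus and turns the imaginary part into a real part, up to
   sign. *)
have := @cR (x * 'i%C); rewrite ReiNIm normrN; apply.
by rewrite normrM [X in _ * X]normc_def /= expr0n expr1n add0r sqrtr1 mulr1.
Qed.

(** The nonnegative terms and the negative terms are two subset sums, each contributing at most
    [c]. *)
Lemma sum_norm_le_subset_sums (I : Type) (s : seq I) (x : I -> R) c :
  (forall P : pred I, `|\sum_(i <- s | P i) x i| <= c) ->
  \sum_(i <- s) `|x i| <= c *+ 2.
Proof.
move=> xc; rewrite (bigID (fun i => 0 <= x i)) /= mulr2n; apply: lerD.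
  rewrite (eq_bigr x); last by move=> i /ger0_norm.
  exact: le_trans (ler_norm _) (xc _).
rewrite (eq_bigr (fun i => - x i)); last first.
  by move=> i; rewrite -ltNge => /ltr0_norm.
by rewrite sumrN; apply: le_trans (ler_norm _) _; rewrite normrN.
Qed.

(** Real and imaginary parts each contribute at most [c *+ 2] in absolute value, while every
    unimodular number contributes at least 1 to the total. *)
Lemma unimodular_subset_sums (I : Type) (s : seq I) (z : I -> R[i]) c :
  (forall i, `|z i| = 1) ->
  (forall P : pred I, `|\sum_(i <- s | P i) z i| <= c%:C) ->
  (size s)%:R <= c *+ 4.
Proof.
move=> z1 zc.
have ReS P : complex.Re (\sum_(i <- s | P i) z i) =
    \sum_(i <- s | P i) complex.Re (z i).
  by apply: (big_morph _ (fun x y => _)) => // -[? ?] [? ?].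
have ImS P : complex.Im (\sum_(i <- s | P i) z i) =
    \sum_(i <- s | P i) complex.Im (z i).
  by apply: (big_morph _ (fun x y => _)) => // -[? ?] [? ?].
have HRe : \sum_(i <- s) `|complex.Re (z i)| <= c *+ 2.
  apply: sum_norm_le_subset_sums => P; rewrite -ReS.
  by have [] := le_complex_norm (zc P).
have HIm : \sum_(i <- s) `|complex.Im (z i)| <= c *+ 2.
  apply: sum_norm_le_subset_sums => P; rewrite -ImS.
  by have [] := le_complex_norm (zc P).
rewrite (mulrnDr c 2 2); apply: le_trans (lerD HRe HIm).
rewrite -big_split /= -sum1_size natr_sum; apply: ler_sum => i _.
(* From [Re ^+ 2 + Im ^+ 2 = 1] follows [|Re| + |Im| >= 1], by squaring. *)
have : (complex.Re (z i) ^+ 2 + complex.Im (z i) ^+ 2)%:C = 1%:C.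
  by rewrite add_Re2_Im2 z1 expr1n.
move=> /complexI; rewrite -(real_normK (num_real (complex.Re _))).
rewrite -(real_normK (num_real (complex.Im _))).
by have := normr_ge0 (complex.Re (z i)); have := normr_ge0 (complex.Im (z i)); nra.
Qed.

(** The supremum [s] of [S] satisfies [2 * s <= s + c]. The bound [b] only makes [s] finite: it may
    depend on the word length without affecting the conclusion. *)
Lemma doubling_bound (S : set R) c b : (forall x, S x -> x <= b) ->
  (forall x, S x -> exists2 y, S y & x *+ 2 <= y + c) -> forall x, S x -> x <= c.
Proof.
move=> Sb Sdbl x Sx.
have hS : has_sup S by split; [exists x | exists b].
have ubS : ubound S (sup S) by apply: sup_upper_bound.
suff : sup S <= (sup S + c) / 2 by have := ubS _ Sx; lra.
apply: ge_sup; first by exists x.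
by move=> y /Sdbl[w /ubS]; lra.
Qed.

End UnimodularSums.

(** * Block digits as polynomials, and transfer to the conjugate *)

Local Notation eval x q := ((map_poly ratr q).[x]).

Section DigitPolynomials.
Variables (A : set int) (k : nat).

Definition digit_poly (q : {poly rat}) : Prop :=
  exists2 a : 'I_k -> int, (forall i, A (a i)) &
    q = \sum_(i < k) (a i)%:~R *: 'X^i.

Lemma eval_digits (K : numFieldType) (x : K) (a : 'I_k -> int) :
  eval x (\sum_(i < k) (a i)%:~R *: 'X^i) = \sum_(i < k) (a i)%:~R * x ^+ i.
Proof.
rewrite rmorph_sum horner_sum; apply: eq_bigr => i _ /=.
by rewrite linearZ /= map_polyXn hornerZ hornerXn ratr_int.
Qed.

Lemma block_alphabetP (K : numFieldType) (x b : K) :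
  block_alphabet x [set a%:~R | a in A] k b <->
  exists2 q, digit_poly q & b = eval x q.
Proof.
split=> [[a Aa <-]|[q [a Aa ->] ->]].
  have /choice[a' Aa'] : forall i, exists a', A a' /\ a'%:~R = a i.
    by move=> i; have [a' ? <-] := Aa i; exists a'.
  exists (\sum_(i < k) (a' i)%:~R *: 'X^i).
    by exists a' => // i; case: (Aa' i).
  by rewrite eval_digits; apply: eq_bigr => i _; case: (Aa' i) => _ ->.
exists (fun i => (a i)%:~R); first by move=> i /=; exists (a i).
by rewrite eval_digits.
Qed.

Lemma digit_poly_const (c : int) : (0 < k)%N -> A 0 -> A c -> digit_poly c%:~R%:P.
Proof.
move=> k0 A0 Ac; exists (fun i => if i == 0%N :> nat then c else 0).
  by move=> i; case: ifP.
rewrite (bigD1 (Ordinal k0)) //= big1 ?addr0 ?expr0 ?alg_polyC // => i.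
by rewrite -val_eqE /= => /negPf ->; rewrite scale0r.
Qed.

Lemma norm_eval_digit_poly (K : numFieldType) (x : K) (L : nat) q : `|x| = 1 ->
  (forall a, A a -> `|a| <= L)%N -> digit_poly q -> `|eval x q| <= (k * L)%:R.
Proof.
move=> x1 AL [a Aa ->]; rewrite eval_digits; apply: le_trans (ler_norm_sum _ _ _) _.
rewrite mulnC natrM mulr_natr -[k in X in _ <= X]card_ord -sumr_const.
apply: ler_sum => i _; rewrite normrM normrX x1 expr1n mulr1 -intr_norm.
by rewrite -abszE -pmulrn ler_nat AL.
Qed.

End DigitPolynomials.

(* The identity between values is a rational polynomial relation satisfied by
   [beta], so it also holds at [gamma]; this is why digits are handled as
   polynomials rather than as complex numbers. *)
Lemma block_addition_at_conjugate (K : numFieldType) (beta gamma : K)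
    (A : set int) (k : nat) : (0 < k)%N -> A 0 ->
  algebraic_conjugate beta gamma ->
  block_parallel_addition beta [set a%:~R | a in A] k ->
  exists r t : nat, forall n (w : nat -> {poly rat}),
    (forall i, digit_poly A k (w i)) ->
    exists2 v : nat -> {poly rat}, forall i, digit_poly A k (v i) &
      (\sum_(t <= i < t + n) eval gamma (w i) * (gamma ^+ k) ^+ i) *+ 2 =
      \sum_(0 <= i < t + n + r) eval gamma (v i) * (gamma ^+ k) ^+ i.
Proof.
move=> k0 A0 conj [phi [phi_conv [p [r [t [pE [Phi phiE]]]]]]].
exists r, t => n w wA.
set B := block_alphabet _ _ _ in phi phi_conv Phi phiE.
have Bw q : digit_poly A k q -> sumset B B (eval beta q + eval beta q).
  move=> qA; have Bq : B (eval beta q) by apply/block_alphabetP; exists q.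
  by exists (eval beta q) => //; exists (eval beta q).
(* The letter [q + q]: the word is added to itself digit by digit. *)
pose dbl q (qA : digit_poly A k q) : sumset B B := SigSub (mem_set (Bw q qA)).
have [|v vE] := local_conversion_nat pE phiE phi_conv
  (fun i => dbl _ (wA i)) (zero := dbl _ (digit_poly_const k0 A0 A0)) n.
  by rewrite /= rmorph0 horner0 addr0.
(* A block digit may come from several digit polynomials; any choice works, since only values at
   [beta] enter the relation [Q]. *)
have /choice[v' v'P] : forall i, exists q, digit_poly A k q /\ val (v i) = eval beta q.
  by move=> i; have /block_alphabetP[q] := set_valP (v i); exists q.
exists v'; first by move=> i; case: (v'P i).
pose Q := (\sum_(t <= i < t + n) w i * ('X^k) ^+ i) *+ 2
          - \sum_(0 <= i < t + n + r) v' i * ('X^k) ^+ i.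
have QE (x : K) : eval x Q =
    (\sum_(t <= i < t + n) eval x (w i) * (x ^+ k) ^+ i) *+ 2 -
    \sum_(0 <= i < t + n + r) eval x (v' i) * (x ^+ k) ^+ i.
  rewrite /Q rmorphB rmorphMn !rmorph_sum hornerD hornerN hornerMn !horner_sum /=.
  by congr (_ *+ 2 - _); apply: eq_bigr => i _;
    rewrite rmorphM !rmorphXn /= map_polyX hornerM !horner_exp hornerX.
have : root (map_poly ratr Q) gamma.
  apply: (conjugate_root conj); rewrite /root QE -sumrMnl subr_eq0.
  apply/eqP; transitivity (\sum_(0 <= i < t + n + r) val (v i) * (beta ^+ k) ^+ i).
    by rewrite -vE; apply: eq_bigr => i _; rewrite /= mulrDl mulr2n.
  by apply: eq_bigr => i _; case: (v'P i) => _ ->.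
by rewrite /root QE subr_eq0 => /eqP.
Qed.

(** * Linear growth against a uniform bound *)

Lemma finite_int_bounded (A : set int) : finite_set A ->
  exists L : nat, forall a, A a -> (`|a| <= L)%N.
Proof.
move=> /finite_seqP[s ->]; exists (\max_(a <- s) `|a|)%N => a /= sa.
by rewrite (big_rem a) //= leq_maxl.
Qed.

Lemma norm_sum_nat_le (K : numFieldType) (x : K) (c : K) (f : nat -> K) m n :
  `|x| = 1 -> (forall i, `|f i| <= c) ->
  `|\sum_(m <= i < n) f i * x ^+ i| <= c *+ (n - m).
Proof.
move=> x1 fc; apply: le_trans (ler_norm_sum _ _ _) _.
rewrite -sumr_const_nat; apply: ler_sum => i _.
by rewrite normrM normrX x1 expr1n mulr1.
Qed.

Theorem theorem7 (R : realType) (beta gamma : R[i]) (A : set int) :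
  1 < `|beta| ->
  algebraic_number beta ->
  algebraic_conjugate beta gamma ->
  `|gamma| = 1 ->
  finite_set A ->
  contiguous A ->
  A 0 ->
  A <> [set 0] ->
  ~ block_parallel_computable beta [set a%:~R | a in A].
Proof.
move=> _ _ conj gamma1 finA _ A0 An0 [k k0 add_k].
have [L AL] := finite_int_bounded finA.
have [a Aa a0] : exists2 a, A a & a != 0.
  apply: contrapT => no; apply: An0; apply/seteqP; split=> [a Aa|a ->] //=.
  by apply/eqP/contraT => a0; exfalso; apply: no; exists a.
have [r [t step]] := block_addition_at_conjugate k0 A0 conj add_k.
have eta1 : `|gamma ^+ k| = 1 by rewrite normrX gamma1 expr1n.
have digit_le q : digit_poly A k q -> `|eval gamma q| <= (k * L)%:R.
  exact: norm_eval_digit_poly.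
(* Bounds the contribution of the [t + r] digits gained by the conversion, independently of the word
   length. *)
pose c : R := (k * L * (t + r))%:R.
pose sum m n (w : nat -> {poly rat}) :=
  \sum_(m <= i < n) eval gamma (w i) * (gamma ^+ k) ^+ i.
have sum_trivial m n w : (forall i, digit_poly A k (w i)) ->
    `|sum m n w| <= (k * L)%:R *+ (n - m).
  by move=> wA; apply: norm_sum_nat_le => // i; apply: digit_le.
have sum_le n w : (forall i, digit_poly A k (w i)) -> `|sum t (t + n)%N w| <= c%:C.
  move=> wA.
  pose S : set R := [set x | exists2 w, (forall i, digit_poly A k (w i)) &
                             `|sum t (t + n)%N w| = x%:C].
  (* Moduli are elements of [R[i]]; their real parts are taken so that the supremum is formed in
     [R]. *)
  have normE (z : R[i]) : `|z| = (complex.Re `|z|)%:C by rewrite RRe_real ?normr_real.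
  rewrite normE lecR; apply: (@doubling_bound _ S c (k * L * n)%:R).
  - move=> x [w' w'A w'x]; rewrite -lecR -w'x rmorph_nat natrM mulr_natr.
    by apply: le_trans (sum_trivial _ _ _ w'A) _; rewrite addKn.
  - move=> x [w' w'A w'x]; have [v vA vE] := step n w' w'A.
    exists (complex.Re `|sum t (t + n)%N v|); first by exists v.
    rewrite -lecR rmorphMn rmorphD /= -normE -w'x -normrMn vE.
    (* The output splits into [t] low digits, a middle block of length [n] whose modulus is again in
       [S], and [r] high digits. *)
    rewrite (big_cat_nat (n := t)) //=; last by rewrite -addnA leq_addr.
    rewrite (big_cat_nat (n := t + n) (m := t)) ?leq_addr //=.
    rewrite addrCA; apply: le_trans (ler_normD _ _) _; apply: lerD => //.
    apply: le_trans (ler_normD _ _) _.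
    rewrite /c rmorph_nat natrM mulr_natr mulrnDr; apply: lerD.
      by apply: le_trans (sum_trivial _ _ _ vA) _; rewrite subn0.
    by apply: le_trans (sum_trivial _ _ _ vA) _; rewrite addKn.
  - by exists w.
have len_le n : n%:R <= c *+ 4.
  have <- : size (index_iota t (t + n)) = n by rewrite size_iota addKn.
  apply: (@unimodular_subset_sums _ _ _ (fun i => (gamma ^+ k) ^+ i)) => [i|P].
    by rewrite normrX eta1 expr1n.
  (* The word with digit [a] on [P] and 0 elsewhere has value [a] times the subset sum, and
     [|a| >= 1] since [a] is a nonzero integer. *)
  pose w i : {poly rat} := if P i then a%:~R%:P else 0%:~R%:P.
  have wA i : digit_poly A k (w i).
    by rewrite /w; case: ifP => _; apply: digit_poly_const.
  apply: le_trans (sum_le n w wA).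
  have -> : sum t (t + n)%N w =
      a%:~R * \sum_(t <= i < t + n | P i) (gamma ^+ k) ^+ i.
    rewrite mulr_sumr [RHS]big_mkcond; apply: eq_bigr => i _; rewrite /w.
    by case: ifP => _; rewrite map_polyC hornerC /= ratr_int // mul0r.
  rewrite normrM; apply: ler_peMl => //.
  by rewrite -intr_norm -abszE -pmulrn ler1n absz_gt0.
(* The length is chosen as [4 * c + 1], one more than the bound allows. *)
have := len_le (k * L * (t + r) * 4).+1.
by rewrite /c -mulrnA ler_nat ltnn.
Qed.
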